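(* The optimal value function $\nu$ and the dual function $\theta$ satisfy the following properties: (a) $\theta(\lambda)=\nu^*(\lambda)$ for all $\lambda\in\mathcal{Y}$ and $\nu^{**}(s)=\theta^*(s)$ for all $s\in\mathcal{Y}$. (b) If $\nu$ is a proper function (namely $\nu(s)>-\infty$ for all $s\in\mathcal{S}$ and there exists $\hat s\in\mathcal{S}$ such that $\nu(\hat s)<+\infty$), then $\theta$ and $\nu^{**}$ are proper lower semi-continuous convex functions (so that $\mathrm{dom}\,\theta\neq\emptyset$ and $\mathrm{dom}\,\nu^{**}\neq\emptyset$). (c) If $\nu$ is a proper lower semi-continuous function, then for any $s\in\mathcal{Y}$, $\nu(s)=\nu^{**}(s)=\theta^*(s)$.
   Context: Standing setting: $\mathcal{Y}$ is a finite dimensional Hilbert space, $K\subset\mathcal{Y}$ is a nonempty closed convex set, $f:\mathbb{R}^n\to\mathbb{R}$ is convex and continuously differentiable, $g:\mathbb{R}^n\to\mathcal{Y}$ is continuously differentiable, and the set-valued mapping $G_K(x)=-g(x)+K$ is graph-convex, i.e. $\{(x,s)\in\mathbb{R}^n\times\mathcal{Y}: g(x)+s\in K\}$ is convex. $\mathcal{S}=\{s\in\mathcal{Y}:\exists x\in\mathbb{R}^n,\ g(x)+s\in K\}$. The optimal value function is $\nu(s)=\inf\{f(x): x\in\mathbb{R}^n,\ g(x)+s\in K\}$ (with $\inf\emptyset=+\infty$). The Lagrangian is $l(x,y,\lambda)=f(x)+\langle\lambda,g(x)-y\rangle$ and the dual function $\theta:\mathcal{Y}\to\overline{\mathbb{R}}$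 is $\theta(\lambda)=-\inf_{x\in\mathbb{R}^n,\,y\in K}l(x,y,\lambda)$. For $h:\mathcal{Y}\to\overline{\mathbb{R}}$, $h^*(\lambda)=\sup_{s\in\mathcal{Y}}\{\langle\lambda,s\rangle-h(s)\}$ is the Fenchel conjugate, $h^{**}=(h^* )^*$, and $\mathrm{dom}\,h=\{h<+\infty\}$. *)

(* Defs.v *)
From HB Require Import structures.
From mathcomp Require Import all_boot all_order all_algebra.
From mathcomp Require Import sesquilinear.
From mathcomp Require Import all_classical all_reals all_analysis.

Set Implicit Arguments.
Unset Strict Implicit.
Unset Printing Implicit Defensive.

Import Order.TTheory GRing.Theory Num.Theory.
Import numFieldNormedType.Exports.

Local Open Scope classical_set_scope.
Local Open Scope ring_scope.

(* Finite dimensional normed spaces. A finite dimensional Hilbert space is such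
   a space Y with a form dot : {dot Y for idfun} satisfying
   dot y y = `|y| ^+ 2; completeness is automatic in finite dimension. *)
#[short(type="normedVectType")]
HB.structure Definition NormedVector (R : realType) :=
  {V of NormedModule R V & Vector R V}.

(* The second conjunct is continuity of x |-> 'd f x for the operator norm,
   which the library does not define. *)
Definition continuously_differentiable (R : realType) (V W : normedModType R)
    (f : V -> W) : Prop :=
  (forall x, differentiable f x) /\
  (forall x (e : R), 0 < e ->
     \forall z \near x, forall v : V, `|'d f z v - 'd f x v| <= e * `|v|).

Section extended_real_functions.
Context (R : realType) (Y : normedVectType R).
Local Open Scope ereal_scope.

Definition effective_domain (h : Y -> \bar R) : set Y := [set s | h s < +oo].

Definition proper_on (D : set Y) (h : Y -> \bar R) : Prop :=
  (forall s, D s -> -oo < h s) /\ (exists2 s, D s & h s < +oo).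

Definition proper_function (h : Y -> \bar R) : Prop := proper_on setT h.

(* Convexity of the epigraph, which avoids sums of opposite infinities. *)
Definition ereal_convex (h : Y -> \bar R) : Prop :=
  convex_set ([set p | h p.1 <= (p.2)%:E] : set (convex_lmodType (Y * R^o)%type)).

Definition fenchel_conjugate (dot : Y -> Y -> R) (h : Y -> \bar R)
    (lam : Y) : \bar R :=
  ereal_sup [set (dot lam s)%:E - h s | s in [set: Y]].

End extended_real_functions.

Section optimization_problem.
Context (R : realType) (n : nat) (Y : normedVectType R).
Variables (dot : Y -> Y -> R) (K : set Y).
Variables (f : 'rV[R]_n -> R) (g : 'rV[R]_n -> Y).

Definition graph_convex : Prop :=
  convex_set ([set p | K (g p.1 + p.2)]
                : set (convex_lmodType ('rV[R]_n * Y)%type)).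

Definition feasible_shifts : set Y := [set s | exists x, K (g x + s)].

Definition optimal_value (s : Y) : \bar R :=
  ereal_inf [set (f x)%:E | x in [set x | K (g x + s)]].

Definition lagrangian (x : 'rV[R]_n) (y lam : Y) : R := f x + dot lam (g x - y).

Definition dual_function (lam : Y) : \bar R :=
  (- ereal_inf [set (lagrangian p.1 p.2 lam)%:E | p in [set: 'rV[R]_n] `*` K])%E.

End optimization_problem.

(* Main.v *)
Require Import Defs.
From HB Require Import structures.
From mathcomp Require Import all_boot all_order all_algebra.
From mathcomp Require Import sesquilinear.
From mathcomp Require Import ring lra.
From mathcomp Require Import all_classical all_reals all_analysis.

Set Implicit Arguments.
Unset Strict Implicit.
Unset Printing Implicit Defensive.

Import Order.TTheory GRing.Theory Num.Theory.
Import numFieldNormedType.Exports.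

Local Open Scope classical_set_scope.
Local Open Scope ring_scope.


(** The optimal value function [nu] is the perturbation function of the problem,
and the statement is Fenchel-Moreau duality for it.

Substituting [s = y - g x] in the Lagrangian turns the infimum over [x] and
[y \in K] that defines [theta] into the supremum that defines the conjugate of
[nu] ([dual_functionE]), so [theta = nu*] and hence [theta* = nu**]; and [nu] is
convex because it is a partial infimum of a jointly convex problem
([optimal_value_convex]). The rest concerns convex functions in general.

A conjugate is a supremum of affine functions, hence always convex and lower
semicontinuous ([conjugate_convex], [conjugate_lsc]). It is finite somewhere as
soon as the function has an affine minorant. So properness of [theta] and of
[nu**] reduces to the fact that a convex function on a finite dimensional space
which never takes the value [-oo] has an affine minorant, lower semicontinuous
or not ([affine_minorant]). This is where finite dimension is used. Instead of
relative interiors, the proof slices the epigraph by hyperplanes [<v, y> = t0],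
one for each vector [v] of a basis. A minorant on a slice with points of the
epigraph on both sides extends to the whole epigraph by tilting it in the
direction [v]: convexity makes every slope forced from one side compatible with
every slope forced from the other ([tilt_minorant]). The level [t0] can always
be put strictly between two values of [<v, y>], unless [<v, y>] is constant.

For the Fenchel-Moreau identity ([fenchel_moreau]) fix a real [a < h s]. Lower
semicontinuity near [s], together with an affine minorant far from [s], places
[h] above the downward cone [a - C |u - s|] ([lsc_cone_minorant]). The cone
generated by the epigraph of [h] seen from [(s, a)] therefore has fibres bounded
below; its affine minorant can be taken linear by homogeneity, which yields an
affine minorant of [h] with value [a] at [s] ([affine_minorant_at]), that is,
[a <= h** s]. No separation theorem or closest point is involved. *)

(** * Convexity in terms of real weights *)

Lemma unit_interval_num (R : realType) (t : R) :
  0 <= t <= 1 -> exists k : {i01 R}, k%:num = t.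
Proof.
move=> /andP[t0 t1].
have ht : Itv.spec (@Itv.num_sem R) (Itv.Real `[0%Z, 1%Z]) t.
  by rewrite /= /Itv.num_sem /= num_real in_itv/= t0 t1.
by exists (Itv.mk ht).
Qed.

Lemma convex_setE (R : realType) (M : lmodType R) (A : set M) :
  convex_set (A : set (convex_lmodType M)) <->
  forall (p q : M) (t : R), 0 <= t <= 1 -> A p -> A q ->
    A (t *: p + (1 - t) *: q).
Proof.
split=> [cA p q t /unit_interval_num[k <-] Ap Aq|cA p q t].
  by have := cA p q k (mem_set Ap) (mem_set Aq); rewrite inE.
by rewrite !inE => Ap Aq; apply: cA => //; rewrite ge0 le1.
Qed.

Lemma convex_functionE (R : realType) (M : lmodType R) (f : M -> R) :
  convex_function ([set: M] : set (convex_lmodType M)) f ->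
  forall (x y : M) (t : R), 0 <= t <= 1 ->
    f (t *: x + (1 - t) *: y) <= t * f x + (1 - t) * f y.
Proof.
move=> cf x y t /unit_interval_num[k <-].
by apply: (cf k x y); rewrite inE.
Qed.

(** * Affine minorants of convex subsets of Y * R *)

Section affine_minorant.
Context (R : realType) (Y : vectType R) (dot : {dot Y for idfun}).
Implicit Types (E : set (Y * R^o)) (lam v : Y) (c t : R).

Lemma dotC u v : dot u v = dot v u.
Proof. by rewrite hermC /= expr0 mul1r. Qed.

Lemma dotDl u v w : dot (u + v) w = dot u w + dot v w.
Proof. exact: linearDl. Qed.

Lemma dotDr u v w : dot u (v + w) = dot u v + dot u w.
Proof. by rewrite dotC dotDl !(dotC u). Qed.

Lemma dotZl t u v : dot (t *: u) v = t * dot u v.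
Proof. by rewrite linearZl_LR. Qed.

Lemma dotZr t u v : dot u (t *: v) = t * dot u v.
Proof. by rewrite dotC dotZl dotC. Qed.

Lemma dotNr u v : dot u (- v) = - dot u v.
Proof. by rewrite -scaleN1r dotZr mulN1r. Qed.

Lemma dotBr u v w : dot u (v - w) = dot u v - dot u w.
Proof. by rewrite dotDr dotNr. Qed.

Lemma dot_eq0 v : dot v v = 0 -> v = 0.
Proof.
move=> vv0; apply/eqP/negPn/negP => /(@neq0_dnorm_gt0 _ _ _ dot).
by rewrite vv0 ltxx.
Qed.

Lemma dot_ext u v : (forall w, w \in vbasis {:Y} -> dot w u = dot w v) -> u = v.
Proof.
move=> uv; apply/subr0_eq/dot_eq0.
rewrite {1}(coord_vbasis (memvf (u - v))).
rewrite dotC raddf_sum big1 // => i _ /=.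
rewrite dotZr (dotC (u - v)) dotBr uv ?subrr ?mulr0 //.
by rewrite memt_nth.
Qed.

(** Write [gap p] for the height of [p] above the given minorant and [tau p] for
its signed distance to the slice. The tilt [k] works when [k * tau p <= gap p]
on [E], so [k] has to lie between the quotients [gap p / tau p] with
[tau p < 0] and those with [tau p > 0]; it exists because the segment joining a
point of each kind meets the slice, where the gap is nonnegative. *)
Lemma tilt_minorant E lam c v t0 :
  convex_set (E : set (convex_lmodType (Y * R^o)%type)) ->
  (exists2 p, E p & dot v p.1 < t0) -> (exists2 q, E q & t0 < dot v q.1) ->
  (forall p, E p -> dot v p.1 = t0 -> dot lam p.1 + c <= p.2) ->
  exists k, forall p, E p -> dot (lam + k *: v) p.1 + (c - k * t0) <= p.2.
Proof.
move=> /convex_setE cE [p0 Ep0 p0lt] [q0 Eq0 q0gt] min0.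
pose gap (p : Y * R^o) := p.2 - (dot lam p.1 + c).
pose tau (p : Y * R^o) := dot v p.1 - t0.
have key p q : E p -> E q -> tau p < 0 -> 0 < tau q ->
    gap p / tau p <= gap q / tau q.
  move=> Ep Eq tp tq.
  have d0 : 0 < tau q - tau p by lra.
  (* The weight for which [tau] vanishes on the segment from [p] to [q]. *)
  pose t := tau q / (tau q - tau p).
  have t01 : 0 <= t <= 1.
    rewrite /t ler_pdivlMr // ler_pdivrMr //; lra.
  have td : t * (tau q - tau p) = tau q by rewrite divfK // gt_eqF.
  have := min0 _ (cE _ _ _ t01 Ep Eq).
  rewrite /= !dotDr !dotZr /GRing.scale /= => H.
  have {}H : 0 <= t * gap p + (1 - t) * gap q.
    rewrite /gap; have := H _.
    move: td; rewrite /tau => td.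
    have /[swap]/[apply] : t * dot v p.1 + (1 - t) * dot v q.1 = t0 by lra.
    lra.
  have : 0 <= tau q * gap p - tau p * gap q.
    have := mulr_ge0 H (ltW d0).
    have -> : tau q * gap p - tau p * gap q =
      t * (tau q - tau p) * gap p +
      (tau q - tau p - t * (tau q - tau p)) * gap q.
      by rewrite td; ring.
    by congr (0 <= _); ring.
  rewrite ler_pdivlMr // mulrAC ler_ndivrMr //; lra.
pose A := [set gap p / tau p | p in [set p | E p /\ tau p < 0]].
have supA : has_sup A.
  split.
    by exists (gap p0 / tau p0), p0 => //; split=> //; rewrite /tau; lra.
  exists (gap q0 / tau q0) => _ [p [Ep tp] <-]; apply: key => //.
  rewrite /tau; lra.
exists (sup A) => p Ep.
suff : sup A * tau p <= gap p.
  by rewrite /gap /tau dotDl dotZl; lra.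
have [tp|tp|tp] := ltgtP (tau p) 0.
- rewrite -ler_ndivrMr //.
  apply: ub_le_sup; first by case: supA.
  by exists p.
- rewrite -ler_pdivlMr //; apply: ge_sup; first by case: supA.
  by move=> _ [q [Eq tq] <-]; apply: key.
- rewrite tp mulr0 /gap; have := min0 p Ep.
  have /[swap]/[apply] : dot v p.1 = t0 by move: tp; rewrite /tau; lra.
  lra.
Qed.

(** The induction on [L] needs only that the vectors still to be processed
separate the first components of the points of [E]: slicing along [v] makes [v]
redundant, and once [L] is empty all points lie over a single [y], where the
bound on the fibre is a constant minorant. *)
Lemma affine_minorant_seq (L : seq Y) E :
  convex_set (E : set (convex_lmodType (Y * R^o)%type)) ->
  (forall y, exists b, forall r, E (y, r) -> b <= r) ->
  (forall p q, E p -> E q -> (forall v, v \in L -> dot v p.1 = dot v q.1) ->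
     p.1 = q.1) ->
  exists lam c, forall p, E p -> dot lam p.1 + c <= p.2.
Proof.
elim: L E => [|v L IH] E cE bE sepE.
  have [->|/set0P[p Ep]] := eqVneq E set0; first by exists 0, 0 => p [].
  have [b hb] := bE p.1.
  exists 0, b => q Eq; rewrite -(scale0r 0) dotZl mul0r add0r.
  by apply: hb; rewrite (sepE p q) // -surjective_pairing.
pose slice t0 := [set p | E p /\ dot v p.1 = t0].
have minslice t0 : exists lam c, forall p, E p -> dot v p.1 = t0 ->
    dot lam p.1 + c <= p.2.
  have [||p q|lam [c H]] := IH (slice t0).
  - apply/convex_setE => p q t t01 [Ep vp] [Eq vq]; split.
      by move/convex_setE: cE; apply.
    by rewrite /= dotDr !dotZr vp vq; ring.
  - by move=> y; have [b hb] := bE y; exists b => r [/hb].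
  - move=> [Ep vp] [Eq vq] pq; apply: sepE => // w.
    rewrite inE => /predU1P[->|/pq//].
    by rewrite vp vq.
  by exists lam, c => p Ep vp; apply: H.
have [cst|] := pselect (forall p q, E p -> E q -> dot v p.1 = dot v q.1).
  have [->|/set0P[p Ep]] := eqVneq E set0; first by exists 0, 0 => p [].
  have [lam [c H]] := minslice (dot v p.1).
  by exists lam, c => q Eq; apply: H => //; apply: cst.
move=> /existsNP[p /existsNP[q /not_implyP[Ep /not_implyP[Eq /eqP pq]]]].
wlog pltq : p q Ep Eq pq / dot v p.1 < dot v q.1.
  move=> W; have [pltq|qltp|/eqP] := ltgtP (dot v p.1) (dot v q.1).
  - exact: W pltq.
  - by apply: W qltp => //; rewrite eq_sym.
  - by rewrite (negbTE pq).
have [lam [c H]] := minslice ((dot v p.1 + dot v q.1) / 2).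
have [||k Hk] := tilt_minorant cE _ _ H.
- by exists p => //; lra.
- by exists q => //; lra.
by exists (lam + k *: v), (c - k * ((dot v p.1 + dot v q.1) / 2)).
Qed.

(** A basis of [Y] separates points because the form is definite. *)
Lemma affine_minorant E :
  convex_set (E : set (convex_lmodType (Y * R^o)%type)) ->
  (forall y, exists b, forall r, E (y, r) -> b <= r) ->
  exists lam c, forall p, E p -> dot lam p.1 + c <= p.2.
Proof.
move=> cE bE; apply: (@affine_minorant_seq (vbasis {:Y})) => // p q _ _.
exact: dot_ext.
Qed.

(** A positively homogeneous minorant based at [(s, a)] can be replaced by a
linear one: [phi] bounds from below the fibres of the cone generated by
[E - (s, a)], and the constant term of an affine minorant of a cone can be
dropped, since its effect vanishes under scaling. *)
Lemma affine_minorant_at E (s : Y) (a : R) (phi : Y -> R) :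
  convex_set (E : set (convex_lmodType (Y * R^o)%type)) ->
  (forall t y, 0 < t -> phi (t *: y) = t * phi y) ->
  (forall p, E p -> a + phi (p.1 - s) <= p.2) ->
  exists lam, forall p, E p -> a + dot lam (p.1 - s) <= p.2.
Proof.
move=> /convex_setE cE phiZ Ephi.
pose cone : set (Y * R^o) :=
  [set d | exists t p, [/\ 0 < t, E p & d = t *: (p - (s, a))]].
have [||lam [c H]] := @affine_minorant cone.
- apply/convex_setE => d1 d2 w /andP[w0 w1].
  move=> [t1 [p1 [t10 Ep1 ->]]] [t2 [p2 [t20 Ep2 ->]]].
  pose T := w * t1 + (1 - w) * t2.
  have T0 : 0 < T.
    rewrite /T; have [->|wn0] := eqVneq w 0.
      by rewrite mul0r add0r subr0 mul1r.
    have : 0 < w * t1 by rewrite mulr_gt0 // lt_neqAle eq_sym wn0.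
    have : 0 <= (1 - w) * t2 by rewrite mulr_ge0 ?subr_ge0 // ltW.
    lra.
  have Tn0 : T != 0 by rewrite gt_eqF.
  (* A combination of two multiples is the [T]-multiple of a combination of the
     points, with weights proportional to [w * t1] and [(1 - w) * t2]. *)
  exists T, (w * t1 / T *: p1 + (1 - w * t1 / T) *: p2); split => //.
    apply: cE => //; apply/andP; split.
      by rewrite divr_ge0 ?mulr_ge0 // ltW.
    by rewrite ler_pdivrMr // mul1r /T lerDl mulr_ge0 ?subr_ge0 // ltW.
  have -> : 1 - w * t1 / T = (1 - w) * t2 / T by rewrite /T; field.
  have sa : (s, a) = (w * t1 / T) *: (s, a) + ((1 - w) * t2 / T) *: (s, a)
      :> Y * R^o.
    rewrite -scalerDl -[LHS]scale1r; congr (_ *: _).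
    by rewrite /T; field.
  rewrite {}[X in _ = _ *: (_ - X)]sa opprD addrACA -!scalerBr.
  rewrite [in RHS]scalerDr !scalerA.
  by congr (_ *: _ + _ *: _); rewrite /T; field.
- move=> y; exists (phi y) => r [t [p [t0 Ep [-> ->]]]].
  rewrite phiZ // /GRing.scale /= ler_pM2l //.
  have := Ephi _ Ep; rewrite /=; lra.
exists lam => p Ep; rewrite leNgt; apply/negP => plt.
pose x := a + dot lam (p.1 - s) - p.2.
have x0 : 0 < x by rewrite /x; lra.
(* A multiple large enough for the defect [t * x] to exceed [`|c|]. *)
pose t := (`|c| + 1) / x.
have t0 : 0 < t by rewrite divr_gt0 // ltr_wpDl.
have : cone (t *: (p - (s, a))) by exists t, p.
move=> /H /=; rewrite dotZr /GRing.scale /= => Hc.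
have tx : t * x = `|c| + 1 by rewrite divfK // gt_eqF.
have := ler_norm (- c); rewrite normrN.
move: tx Hc; rewrite /x; lra.
Qed.

End affine_minorant.

(** * Fenchel conjugates *)

Section conjugate.
Context (R : realType) (Y : normedVectType R) (dot : {dot Y for idfun}).
Implicit Types (h : Y -> \bar R) (lam s : Y).
Local Notation conj := (fenchel_conjugate dot).

Lemma conjugate_ge h lam s : ((dot lam s)%:E - h s <= conj h lam)%E.
Proof. by apply: ereal_sup_ubound; exists s. Qed.

(** Moving [h s] to the other side avoids differences of extended reals: [-r] is
the constant term of an affine minorant of [h] with slope [lam]. *)
Lemma conjugate_leP h lam r :
  (conj h lam <= r%:E)%E <-> (forall s, (dot lam s - r)%:E <= h s)%E.
Proof.
split=> [H s|H].
  have := le_trans (conjugate_ge h lam s) H.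
  case: (h s) => [v| |] //=; rewrite ?leey // -EFinB !lee_fin; lra.
apply: ge_ereal_sup => _ [s _ <-]; have := H s.
case: (h s) => [v| |] //=; rewrite -?EFinB ?lee_fin ?leNye //; lra.
Qed.

Lemma biconjugate_le h s : (conj (conj h) s <= h s)%E.
Proof.
apply: ge_ereal_sup => _ [lam _ <-]; have := conjugate_ge h lam s.
rewrite (dotC dot s).
case: (h s) => [v| |] /=; rewrite ?leey //.
  case: (conj h lam) => [w| |] //=; rewrite -?EFinB ?lee_fin ?leNye //; lra.
by rewrite leye_eq => /eqP ->.
Qed.

Lemma biconjugate_ge h s a lam :
  (forall u, (a + dot lam (u - s))%:E <= h u)%E -> (a%:E <= conj (conj h) s)%E.
Proof.
move=> H.
have : (conj h lam <= (dot lam s - a)%:E)%E.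
  apply/conjugate_leP => u; apply: le_trans (H u).
  by rewrite lee_fin dotBr; lra.
have := conjugate_ge (conj h) s lam; rewrite (dotC dot s).
case: (conj h lam) => [w| |] //=; rewrite -?EFinB ?leye_eq.
  move=> /[swap]; rewrite lee_fin => ws; apply: le_trans.
  by rewrite lee_fin; lra.
by move=> /eqP -> _; rewrite leey.
Qed.

Lemma conjugate_convex h : ereal_convex (conj h).
Proof.
apply/convex_setE => p q t /andP[t0 t1] /conjugate_leP Hp /conjugate_leP Hq.
apply/conjugate_leP => s; have := Hp s; have := Hq s.
case: (h s) => [v| |] //=; rewrite ?leey // !lee_fin dotDl !dotZl.
rewrite /GRing.scale /= => hq hp.
have := ler_wpM2l t0 hp.
have : 0 <= 1 - t by lra.
move=> /ler_wpM2l /(_ _ _ hq); lra.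
Qed.

Context (hdot : forall y : Y, dot y y = `|y| ^+ 2).

Lemma dot_polar u v : dot u v = (`|u + v| ^+ 2 - `|u| ^+ 2 - `|v| ^+ 2) / 2.
Proof. by rewrite -!hdot !(dotDl, dotDr) (dotC dot v u); field. Qed.

(** The Cauchy-Schwarz inequality is the squared triangle inequality. *)
Lemma dot_le_norm u v : dot u v <= `|u| * `|v|.
Proof.
rewrite dot_polar ler_pdivrMr //.
have : `|u + v| ^+ 2 <= (`|u| + `|v|) ^+ 2.
  by rewrite ler_sqr ?nnegrE ?addr_ge0 // ler_normD.
rewrite sqrrD; lra.
Qed.

Lemma dot_ge_norm u v : - (`|u| * `|v|) <= dot u v.
Proof. by rewrite lerNl -dotNr (le_trans (dot_le_norm _ _)) // normrN. Qed.

(** For a fixed [s], [lam |-> <lam, s> - h s] is continuous, and a supremum of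
continuous functions is lower semicontinuous. *)
Lemma conjugate_lsc h : lower_semicontinuous (conj h).
Proof.
move=> lam a /ereal_sup_gt[_ [s _ <-] alt].
suff [e e0 He] : exists2 e : R, 0 < e &
    forall mu, `|lam - mu| < e -> (a%:E < (dot mu s)%:E - h s)%E.
  exists (ball lam e); first exact: nbhsx_ballx.
  move=> mu /=; rewrite -ball_normE /= => /He /lt_le_trans; apply.
  exact: conjugate_ge.
move: alt; case: (h s) => [v| |] //=; last by exists 1.
rewrite -EFinB lte_fin => alt.
have s0 : 0 < `|s| + 1 by rewrite ltr_wpDl.
(* The denominator is [`|s| + 1] rather than [`|s|], which may vanish. *)
exists ((dot lam s - v - a) / (`|s| + 1)).
  by rewrite divr_gt0 // subr_gt0.
move=> mu; rewrite ltr_pdivlMr // => Hmu; rewrite -EFinB lte_fin.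
have := dot_le_norm (lam - mu) s.
rewrite dotDl -(scaleN1r mu) dotZl scaleN1r => D.
have := normr_ge0 (lam - mu); lra.
Qed.

Lemma convex_affine_minorant h :
  ereal_convex h -> (forall s, -oo < h s)%E ->
  exists lam c, forall s, ((dot lam s + c)%:E <= h s)%E.
Proof.
move=> ch hNy.
have [|lam [c H]] := affine_minorant dot ch.
  move=> y; have := hNy y; case hy : (h y) => [v| |] // _.
  - by exists v => r; rewrite /= hy lee_fin.
  - by exists 0 => r; rewrite /= hy.
exists lam, c => s; have := hNy s; case hs : (h s) => [v| |] // _.
  by rewrite lee_fin; apply: (H (s, v)); rewrite /= hs.
by rewrite leey.
Qed.

(** On the ball of radius [e] where [h > a] any slope [C >= 0] will do. Outside
it, the affine minorant lies above [m - |lam| |u - s|], [m] being its value at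
[s], and the deficit [a - m] is absorbed by the additional slope [|a - m| / e],
as [|u - s| >= e]. *)
Lemma lsc_cone_minorant h s a lam c :
  lower_semicontinuous h -> (a%:E < h s)%E ->
  (forall u, ((dot lam u + c)%:E <= h u)%E) ->
  exists C, forall u, ((a - C * `|u - s|)%:E <= h u)%E.
Proof.
move=> lsch ahs minh; have [V /nbhs_ballP[e /= e0 eV] Vh] := lsch _ _ ahs.
pose m := dot lam s + c.
exists (`|lam| + `|a - m| / e) => u.
have q0 : 0 <= `|a - m| / e by rewrite divr_ge0 // ltW.
have [ue|eu] := ltP `|u - s| e.
  have /Vh /ltW : V u by apply: eV; rewrite -ball_normE /= distrC.
  apply: le_trans; rewrite lee_fin gerBl.
  by rewrite mulr_ge0 // addr_ge0.
apply: le_trans (minh u); rewrite lee_fin.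
have : `|a - m| <= `|a - m| / e * `|u - s|.
  by rewrite mulrAC ler_pdivlMr // ler_wpM2l.
have := ler_norm (a - m).
have := dot_ge_norm lam (u - s).
rewrite dotBr /m; lra.
Qed.

(** It suffices to bound [h**] from below by every real [a < h s]; this handles
[h s = +oo] together with the finite values, so that no case of a vertical
supporting hyperplane arises. *)
Lemma fenchel_moreau h :
  ereal_convex h -> lower_semicontinuous h -> (forall s, -oo < h s)%E ->
  forall s, conj (conj h) s = h s.
Proof.
move=> ch lsch hNy s; apply/eqP; rewrite eq_le biconjugate_le /=.
have [lam0 [c0 min0]] := convex_affine_minorant ch hNy.
have real_below a : (a%:E < h s)%E -> (a%:E <= conj (conj h) s)%E.
  move=> ahs; have [C HC] := lsc_cone_minorant lsch ahs min0.
  have [||lam Hlam] :=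
    @affine_minorant_at _ _ dot _ s a (fun y => - (C * `|y|)) ch.
  - by move=> t y t0; rewrite normrZ gtr0_norm //; ring.
  - move=> [u r] /= hur; rewrite -lee_fin; exact: le_trans (HC u) hur.
  apply: (@biconjugate_ge _ _ _ lam) => u.
  have := hNy u; case hu : (h u) => [v| |] // _; last by rewrite leey.
  by rewrite lee_fin; apply: (Hlam (u, v)); rewrite /= hu.
have := hNy s; case hs : (h s) => [v| |] // _.
  apply/lee_subgt0Pr => e e0; rewrite -EFinB; apply: real_below.
  by rewrite hs lte_fin; lra.
rewrite leye_eq; apply/eqP; apply: eq_infty => a; apply: real_below.
by rewrite hs ltry.
Qed.

End conjugate.

(** * Duality for the optimal value function *)

Section perturbation_duality.
Context (R : realType) (n : nat) (Y : normedVectType R).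
Context (dot : {dot Y for idfun}) (K : set Y).
Context (f : 'rV[R]_n -> R) (g : 'rV[R]_n -> Y).
Local Notation nu := (optimal_value K f g).

Lemma optimal_value_le x s : K (g x + s) -> (nu s <= (f x)%:E)%E.
Proof. by move=> Kx; apply: ereal_inf_lbound; exists x. Qed.

Lemma optimal_value_out s : ~ feasible_shifts K g s -> nu s = +oo%E.
Proof.
by move=> Ss; apply/ereal_inf_pinfty => _ [x Kx <-]; case: Ss; exists x.
Qed.

(** Up to sign, [lagrangian x y lam] is [<lam, s> - f x] with [s = y - g x], and
[y \in K] says that [x] is feasible for the shift [s]. Nonemptiness of [K] rules
out [theta lam = -oo]. *)
Lemma dual_functionE : K !=set0 ->
  dual_function dot K f g =1 fenchel_conjugate dot nu.
Proof.
move=> [y0 Ky0] lam; apply/eqP; rewrite eq_le; apply/andP; split.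
  rewrite leeNl; apply: le_ereal_inf_tmp => _ [[x y] [_ /= Ky] <-].
  rewrite leeNl; apply: le_trans (conjugate_ge dot nu lam (y - g x)).
  have : (nu (y - g x)%R <= (f x)%:E)%E.
    by apply: optimal_value_le; rewrite addrC addrNK.
  case: (nu _) => [v| |] //=; rewrite -?EFinN -?EFinB ?leey // !lee_fin.
  rewrite /lagrangian !dotBr; lra.
have lagr x y : K y ->
    (- (lagrangian dot f g x y lam)%:E <= dual_function dot K f g lam)%E.
  move=> Ky; rewrite leeNr oppeK; apply: ereal_inf_lbound.
  by exists (x, y).
move: lagr; case: (dual_function _ _ _ _ _) => [r| |] lagr; last first.
- by have := lagr 0 y0 Ky0.
- exact: leey.
apply/conjugate_leP => s; apply: le_ereal_inf_tmp => _ [x /= Kx <-].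
have := lagr x _ Kx; rewrite -EFinN !lee_fin /lagrangian dotBr dotDr; lra.
Qed.

(** The infimum need not be attained, so the epigraph inequality is proved up to
[e > 0], with points that are feasible and [e]-optimal. *)
Lemma optimal_value_convex :
  convex_function ([set: 'rV[R]_n] : set (convex_lmodType 'rV[R]_n)) f ->
  graph_convex K g -> ereal_convex nu.
Proof.
move=> /convex_functionE cf /convex_setE cg.
apply/convex_setE => p q t t01 /= Hp Hq.
have [t0 t1] := andP t01.
have near (s : Y) (r e : R) : 0 < e -> (nu s <= r%:E)%E ->
    exists2 x, K (g x + s) & f x < r + e.
  move=> e0 sr; have : (nu s < (r + e)%:E)%E.
    by apply: le_lt_trans sr _; rewrite lte_fin ltrDl.
  by move=> /ereal_inf_lt[_ [x Kx <-]]; rewrite lte_fin; exists x.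
apply/lee_addgt0Pr => e e0.
have [x Kx fx] := near _ _ _ e0 Hp; have [y Ky fy] := near _ _ _ e0 Hq.
have Kxy := cg (x, p.1) (y, q.1) t t01 Kx Ky.
apply: le_trans (optimal_value_le Kxy) _.
rewrite -EFinD lee_fin; apply: le_trans (cf _ _ _ t01) _.
rewrite /GRing.scale /=.
have := ler_wpM2l t0 (ltW fx).
have /ler_wpM2l /(_ _ _ (ltW fy)) : 0 <= 1 - t by lra.
lra.
Qed.

End perturbation_duality.

Theorem proposition3p2 (R : realType) (n : nat) (Y : normedVectType R)
    (dot : {dot Y for idfun}) (hdot : forall y : Y, dot y y = `|y| ^+ 2)
    (K : set Y) (K_nonempty : K !=set0) (K_closed : closed K)
    (K_convex : convex_set (K : set (convex_lmodType Y)))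
    (f : 'rV[R]_n -> R)
    (f_convex : convex_function
       ([set: 'rV[R]_n] : set (convex_lmodType 'rV[R]_n)) f)
    (f_C1 : continuously_differentiable f)
    (g : 'rV[R]_n -> Y) (g_C1 : continuously_differentiable g)
    (gK_convex : graph_convex K g) :
  let S := feasible_shifts K g in
  let nu := optimal_value K f g in
  let theta := dual_function dot K f g in
  let nu' := fenchel_conjugate dot nu in
  let nu'' := fenchel_conjugate dot nu' in
  let theta' := fenchel_conjugate dot theta in
  [/\ (forall lam, theta lam = nu' lam) /\ (forall s, nu'' s = theta' s),
      proper_on S nu ->
        [/\ [/\ proper_function theta, lower_semicontinuous theta
              & ereal_convex theta],
            [/\ proper_function nu'', lower_semicontinuous nu''
              & ereal_convex nu''],
            effective_domain theta !=set0 & effective_domain nu'' !=set0]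
    & proper_on S nu -> lower_semicontinuous nu ->
        forall s, nu s = nu'' s /\ nu'' s = theta' s].
Proof.
move=> S nu theta nu' nu'' theta'.
have theta_nu' : theta = nu' by apply/funext/dual_functionE.
have theta'_nu'' : theta' = nu'' by rewrite /theta' theta_nu'.
have nuNy : proper_on S nu -> forall s, (-oo < nu s)%E.
  move=> [H _] s; have [/H//|Ss] := pselect (S s).
  by rewrite /nu optimal_value_out.
have nu_convex : ereal_convex nu by apply: optimal_value_convex.
split.
- by rewrite theta_nu' theta'_nu''.
- move=> pnu; have [_ [s0 _ nus0]] := pnu.
  have [lam [c minnu]] := convex_affine_minorant dot nu_convex (nuNy pnu).
  have nu'lam : (nu' lam < +oo)%E.
    apply: le_lt_trans (ltry (- c)); apply/conjugate_leP => s.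
    by rewrite opprK.
  have nu''s0 : (nu'' s0 < +oo)%E.
    exact: le_lt_trans (biconjugate_le dot nu s0) nus0.
  have nu'Ny mu : (-oo < nu' mu)%E.
    apply: lt_le_trans (conjugate_ge dot nu mu s0).
    by move: nus0; case: (nu s0) => // *; rewrite ?ltNye.
  have nu''Ny s : (-oo < nu'' s)%E.
    apply: lt_le_trans (conjugate_ge dot nu' s lam).
    by move: nu'lam; case: (nu' lam) => // *; rewrite ?ltNye.
  rewrite theta_nu'; split.
  + split; last exact: conjugate_convex.
      by split=> [mu _|]; [exact: nu'Ny | exists lam].
    exact: conjugate_lsc.
  + split; last exact: conjugate_convex.
      by split=> [s _|]; [exact: nu''Ny | exists s0].
    exact: conjugate_lsc.
  + by exists lam.
  + by exists s0.
- move=> pnu lscnu s; rewrite theta'_nu''; split=> //.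
  by rewrite /nu'' /nu' fenchel_moreau //; exact: nuNy.
Qed.
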